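(* For all integers $r,z\ge1$ and $k\ge4$, there is no $(r,z,k;-1)$-graph.
   Context: A mixed graph $G$ consists of a finite vertex set $V(G)$, a set $E(G)$ of edges (unordered pairs of distinct vertices; $x\sim y$ means $\{x,y\}\in E(G)$) and a set $A(G)$ of arcs (ordered pairs of distinct vertices; $x\to y$ means $(x,y)\in A(G)$), with at most one edge or arc between any two vertices (so no two vertices are joined by both an edge and an arc, nor by arcs in both directions). The order of $G$ is $|V(G)|$. For a vertex $v$, the undirected degree is the number of $u$ with $u\sim v$ and the directed out-degree is the number of $u$ with $v\to u$. A walk of length $m$ from $u$ to $v$ is a sequence $u=v_0,\dots,v_m=v$ with $v_i\sim v_{i+1}$ or $v_i\to v_{i+1}$ for each $i<m$; a path is a walk with distinct vertices. The distance $d(u,v)$ is the length of a shortest path from $u$ to $v$ ($\infty$ if none), and the diameter of $G$ is the maximum of $d(u,v)$ over all ordered pairs of vertices. Mixed Moore bound: $M(r,z,k)=A\frac{u_1^{k+1}-1}{u_1-1}+B\frac{u_2^{k+1}-1}{u_2-1}$, where $w=(z+r)^2+2(z-r)+1$, $u_1=\frac{z+r-1-\sqrt w}{2}$, $u_2=\frac{z+r-1+\sqrt w}{2}$, $A=\frac{\sqrt w-(z+r+1)}{2\sqrt w}$, $B=\frac{\sqrt w+(z+r+1)}{2\sqrt w}$. An $(r,z,k;-\delta)$-graph is a mixed graph of diameter $k$ with maximum undirected degree $r$, maximum directed out-degree $z$ and order $M(r,z,k)-\delta$. *)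

(* Defs.v *)
From mathcomp Require Import all_boot all_order all_algebra.
From mathcomp Require Import constructive_ereal reals.

Set Implicit Arguments.
Unset Strict Implicit.
Unset Printing Implicit Defensive.

Import Order.TTheory GRing.Theory Num.Theory.

Local Open Scope ring_scope.

(* The set of edges is given by a symmetric irreflexive relation, the set of
   arcs by a relation. *)
Record mixedGraph := MixedGraph {
  vertex :> finType;
  edge : rel vertex;
  arc : rel vertex;
  edge_sym : symmetric edge;
  edge_irr : irreflexive edge;
  arc_irr : irreflexive arc;
  edge_not_arc : forall x y, edge x y -> ~~ arc x y;
  arc_asym : forall x y, arc x y -> ~~ arc y x
}.

Section MixedGraph.
Variable G : mixedGraph.

Definition undirected_degree (v : G) : nat := #|[set u : G | edge v u]|.

Definition directed_outdegree (v : G) : nat := #|[set u : G | arc v u]|.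

Definition max_undirected_degree : nat :=
  (\max_(v : G) undirected_degree v)%N.

Definition max_directed_outdegree : nat :=
  (\max_(v : G) directed_outdegree v)%N.

Definition step : rel G := [rel x y | edge x y || arc x y].

(* The sequence of vertices of the walk is u :: p, so its length is size p. *)
Definition is_walk (u v : G) (p : seq G) : bool :=
  path step u p && (last u p == v).

Definition is_path (u v : G) (p : seq G) : bool :=
  is_walk u v p && uniq (u :: p).

(* As its vertices are distinct, every path u :: p satisfies size p < #|G|, so
   the index type {bseq #|G| of G} (sequences of size at most #|G|) contains
   all of them. *)
Definition distance (u v : G) : \bar int :=
  \big[Order.min/+oo%E]_(p : {bseq #|G| of G} | is_path u v p)
    ((size p)%:Z)%:E.

Definition diameter : \bar int :=
  \big[Order.max/-oo%E]_(uv : G * G) distance uv.1 uv.2.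

End MixedGraph.

Section MooreBound.
Variables (R : realType) (r z : nat).

Definition moore_w : R := (z%:R + r%:R) ^+ 2 + 2 * (z%:R - r%:R) + 1.

Definition moore_u1 : R := (z%:R + r%:R - 1 - Num.sqrt moore_w) / 2.

Definition moore_u2 : R := (z%:R + r%:R - 1 + Num.sqrt moore_w) / 2.

Definition moore_A : R :=
  (Num.sqrt moore_w - (z%:R + r%:R + 1)) / (2 * Num.sqrt moore_w).

Definition moore_B : R :=
  (Num.sqrt moore_w + (z%:R + r%:R + 1)) / (2 * Num.sqrt moore_w).

(* For r, z >= 1 no denominator vanishes, since
   w = (z + r - 1)^2 + 4z > 0 and u1 < 0 < 1 < u2. *)
Definition mixed_moore_bound (k : nat) : R :=
  moore_A * ((moore_u1 ^+ k.+1 - 1) / (moore_u1 - 1)) +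
  moore_B * ((moore_u2 ^+ k.+1 - 1) / (moore_u2 - 1)).

End MooreBound.

(* This is an (r, z, k; -delta)-graph in the usual notation. *)
Definition defect_graph (R : realType) (r z k delta : nat) (G : mixedGraph) :
    Prop :=
  [/\ diameter G = (k%:Z)%:E,
      max_undirected_degree G = r,
      max_directed_outdegree G = z &
      #|G|%:R = mixed_moore_bound R r z k - delta%:R].

(* Main.v *)
From Pilot Require Import Defs.
From mathcomp Require Import all_boot all_order all_algebra.
From mathcomp Require Import constructive_ereal reals.
From mathcomp Require Import ring lra zify.
(* [path.arc] would otherwise hide the arcs of a mixed graph. *)
Import Pilot.Defs.

(* A graph as in the theorem has all degrees equal to [r] and [z], and from each
   vertex [u] the nonbacktracking walks of length at most [k] reach every vertex
   once, except a single vertex [rho u], reached twice. Counting these walks by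
   prepending or by appending a step gives recurrences for the matrix [S_k] of
   their numbers, whose comparison yields, with [Z] the arcs and [A] all steps,
     [A S_k - S_k A = Z S_(k-2) - S_(k-2) Z], where [S_k = J + rho].
   In the difference of the rows of the two ends of an edge, the irregular
   in-degrees hidden in [A J - J A] cancel and what remains on the left has norm
   at most [4 (r + z)], while the walks counted on the right end almost all at
   distinct vertices. This is impossible unless [r = z = 1] and [k = 4].

   In that last case edges and arcs are given by an involution [e] and a map
   [f]. If [s] is not a value of [f], then [e s] is one of [rho u], [f u] and
   [f (f u)] for all [u], and comparing the rows of [s] and [e s] is
   contradictory; otherwise [f] is injective, [A J = J A], and the rows force [f]
   and [e] to commute, which creates two repeated vertices. *)

Set Implicit Arguments.
Unset Strict Implicit.
Unset Printing Implicit Defensive.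

Import Order.TTheory GRing.Theory Num.Theory.

Local Open Scope ring_scope.

(** * Nonbacktracking walks *)

Section Walks.
Variable G : mixedGraph.
Implicit Types (f g : G -> int) (u v x y : G).

Definition edge_sum f u := \sum_(y | edge u y) f y.

Definition arc_sum f u := \sum_(y | arc u y) f y.

Definition step_sum f u := edge_sum f u + arc_sum f u.

(* Sum of [f] over the ends of the nonbacktracking walks (those which never use
   the same edge twice in a row) of length at most [m] from [u] whose first step
   is not the edge to [x]. As [u] is not adjacent to itself, [x = u] means no
   restriction. *)
Fixpoint nb_sum f m x u : int :=
  if m is m'.+1 then
    f u + \sum_(y | edge u y && (y != x)) nb_sum f m' u y
        + \sum_(y | arc u y) nb_sum f m' y y
  else f u.

Definition ball_sum f m u := nb_sum f m u u.

(** [ball_sum (delta v) m u] counts the walks ending at [v]: it is the entry of [S_m] in row [u] and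
    column [v]. *)
Definition delta v : G -> int := fun w => (w == v)%:R.

Lemma sum_delta (g : G -> int) v : \sum_w g w * delta v w = g v.
Proof.
rewrite (bigD1 v) //= /delta eqxx mulr1 big1 ?addr0 // => w /negPf ->.
by rewrite mulr0.
Qed.

Lemma sum_delta1 v : \sum_w delta w v = 1.
Proof.
rewrite (bigD1 v) //= /delta eqxx big1 ?addr0 // => w.
by rewrite eq_sym => /negPf ->.
Qed.

Lemma eq_nb_sum f g m x u : f =1 g -> nb_sum f m x u = nb_sum g m x u.
Proof.
move=> fg; elim: m x u => [|m IHm] x u /=; first exact: fg.
by rewrite fg; congr (_ + _ + _); apply: eq_bigr => y _; apply: IHm.
Qed.

Lemma nb_sum_sum (I : finType) (F : I -> G -> int) m x u :
  nb_sum (fun w => \sum_i F i w) m x u = \sum_i nb_sum (F i) m x u.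
Proof.
elim: m x u => [//|m IHm] x u /=; rewrite !big_split /=.
by congr (_ + _ + _); rewrite exchange_big; apply: eq_bigr => y _; apply: IHm.
Qed.

Lemma nb_sumZ c f m x u :
  nb_sum (fun w => c * f w) m x u = c * nb_sum f m x u.
Proof.
elim: m x u => [//|m IHm] x u /=; rewrite !mulrDr !mulr_sumr.
by congr (_ + _ + _); apply: eq_bigr => y _; apply: IHm.
Qed.

Lemma nb_sumE f m x u :
  nb_sum f m x u = \sum_v f v * nb_sum (delta v) m x u.
Proof.
rewrite (@eq_nb_sum _ (fun w => \sum_v f v * delta v w)); last first.
  move=> w; rewrite (bigD1 w) //= /delta eqxx mulr1 big1 ?addr0 // => v.
  by rewrite eq_sym => /negPf ->; rewrite mulr0.
by rewrite nb_sum_sum; apply: eq_bigr => v _; apply: nb_sumZ.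
Qed.

Lemma nb_sum_ge0 f m x u : (forall w, 0 <= f w) -> 0 <= nb_sum f m x u.
Proof.
move=> f_ge0; elim: m x u => [|m IHm] x u /=; first exact: f_ge0.
by rewrite !addr_ge0 ?sumr_ge0.
Qed.

Lemma arc_sum_ge0 f u : (forall w, 0 <= f w) -> 0 <= arc_sum f u.
Proof. by move=> f_ge0; apply: sumr_ge0. Qed.

Lemma leS_nb_sum f m x u :
  (forall w, 0 <= f w) -> nb_sum f m x u <= nb_sum f m.+1 x u.
Proof.
move=> f_ge0; elim: m x u => [|m IHm] x u.
  by rewrite /= -addrA lerDl addr_ge0 ?sumr_ge0.
by rewrite /= !lerD // ler_sum.
Qed.

(* Appending a final arc to a walk is injective, and never gives the empty
   walk. *)
Lemma nb_sum_arc_le f m x u :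
  (forall w, 0 <= f w) ->
  f u + nb_sum (arc_sum f) m x u <= nb_sum f m.+1 x u.
Proof.
move=> f_ge0; elim: m x u => [|m IHm] x u.
  by rewrite /= /arc_sum lerD2r lerDl sumr_ge0.
have edges_le : \sum_(y | edge u y && (y != x)) nb_sum (arc_sum f) m u y
    <= \sum_(y | edge u y && (y != x)) nb_sum f m.+1 u y.
  by apply: ler_sum => y _; apply: le_trans (IHm _ _); rewrite lerDr.
have arcs_le : arc_sum f u + \sum_(y | arc u y) nb_sum (arc_sum f) m y y
    <= \sum_(y | arc u y) nb_sum f m.+1 y y.
  by rewrite -big_split; apply: ler_sum => y _; apply: IHm.
rewrite -[nb_sum f m.+2 x u]/(f u
  + \sum_(y | edge u y && (y != x)) nb_sum f m.+1 u y
  + \sum_(y | arc u y) nb_sum f m.+1 y y).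
rewrite -[nb_sum _ m.+1 x u]/(arc_sum f u
  + \sum_(y | edge u y && (y != x)) nb_sum (arc_sum f) m u y
  + \sum_(y | arc u y) nb_sum (arc_sum f) m y y).
lia.
Qed.

(** Either the first step is not the edge to [x], or it is, and the walk goes on from [x] without
    returning at once. *)
Lemma ball_sum_edge f m x u : edge u x ->
  ball_sum f m.+1 u = nb_sum f m.+1 x u + nb_sum f m u x.
Proof.
move=> ux; rewrite /ball_sum /=.
rewrite (bigD1 (P := fun y => edge u y && (y != u)) x) /=; last first.
  by rewrite ux; apply: contraTneq ux => ->; rewrite edge_irr.
rewrite (eq_bigl (fun y => edge u y && (y != x))); first by ring.
move=> y; case: (boolP (edge u y)) => //= uy.
by have -> : y != u; [apply: contraTneq uy => ->; rewrite edge_irr|].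
Qed.

Lemma nb_sum_split f m u :
  ball_sum f m.+1 u
  = f u + \sum_(y | edge u y) nb_sum f m u y + arc_sum (ball_sum f m) u.
Proof.
rewrite /ball_sum /=; congr (_ + _ + _); apply: eq_bigl => y.
case: (boolP (edge u y)) => //= uy.
by apply: contraTneq uy => ->; rewrite edge_irr.
Qed.

End Walks.

(** * From prepending steps to appending them *)

Section TwoSidedRecurrence.
Variables (T : Type) (A Z : (T -> int) -> T -> int) (r : int).
Variable S : nat -> (T -> int) -> T -> int.
(** Linearity in the shape of the recurrence; the pointwise premise avoids equalities of
    functions. *)
Hypothesis A_lin : forall (f f1 f2 f3 : T -> int) (c : int),
  (forall y, f y = f1 y - c * f2 y - f3 y) ->
  forall u, A f u = A f1 u - c * A f2 u - A f3 u.
Hypothesis Z_lin : forall (f f1 f2 f3 : T -> int) (c : int),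
  (forall y, f y = f1 y - c * f2 y - f3 y) ->
  forall u, Z f u = Z f1 u - c * Z f2 u - Z f3 u.
Hypothesis S0 : forall f u, S 0 f u = f u.
Hypothesis S1 : forall f u, S 1 f u = f u + A f u.
Hypothesis S2 : forall f u, S 2 f u = f u + A (S 1 f) u - r * f u.
Hypothesis S_recl : forall f m u,
  S m.+3 f u = A (S m.+2 f) u - (r - 1) * S m.+1 f u - Z (S m f) u.

(* With the operators applied first instead of last. *)
Lemma two_sided_recurrence f m u :
  S m.+3 f u = S m.+2 (A f) u - (r - 1) * S m.+1 f u - S m (Z f) u.
Proof.
have A0 u' : A (fun=> 0) u' = 0.
  have /(_ u') := A_lin (f := fun=> 0) (f1 := fun=> 0) (f2 := fun=> 0)
    (f3 := fun=> 0) (c := 0) (fun=> erefl).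
  by rewrite mul0r subr0 subrr.
have Z0 u' : Z (fun=> 0) u' = 0.
  have /(_ u') := Z_lin (f := fun=> 0) (f1 := fun=> 0) (f2 := fun=> 0)
    (f3 := fun=> 0) (c := 0) (fun=> erefl).
  by rewrite mul0r subr0 subrr.
have AS0 g w : A (S 0 g) w = A g w.
  by rewrite (A_lin (f1 := g) (f2 := fun=> 0) (f3 := fun=> 0) (c := 0))
    ?A0 => [|y]; rewrite ?S0; ring.
have ZS0 g w : Z (S 0 g) w = Z g w.
  by rewrite (Z_lin (f1 := g) (f2 := fun=> 0) (f3 := fun=> 0) (c := 0))
    ?Z0 => [|y]; rewrite ?S0; ring.
have AS1 g w : A (S 1 g) w = A g w + A (A g) w.
  rewrite (A_lin (f1 := g) (f2 := A g) (f3 := fun=> 0) (c := -1)) ?A0 => [|y].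
    by ring.
  by rewrite S1; ring.
have ZS1 g w : Z (S 1 g) w = Z g w + Z (A g) w.
  rewrite (Z_lin (f1 := g) (f2 := A g) (f3 := fun=> 0) (c := -1)) ?Z0 => [|y].
    by ring.
  by rewrite S1; ring.
have S2r g w : S 2 g w = S 1 (A g) w + (1 - r) * g w.
  by rewrite S2 S1 AS1; ring.
have AS2 g w : A (S 2 g) w = A (S 1 (A g)) w - (r - 1) * A g w.
  rewrite (A_lin (f1 := S 1 (A g)) (f2 := g) (f3 := fun=> 0) (c := r - 1))
    ?A0 => [|y]; rewrite ?S2r; ring.
have ZS2 g w : Z (S 2 g) w = Z (S 1 (A g)) w - (r - 1) * Z g w.
  rewrite (Z_lin (f1 := S 1 (A g)) (f2 := g) (f3 := fun=> 0) (c := r - 1))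
    ?Z0 => [|y]; rewrite ?S2r; ring.
elim/ltn_ind: m f u => -[|[|[|m]]] IH f u.
- by rewrite S_recl AS2 S2 ZS0 S0; ring.
- rewrite S_recl (A_lin (IH 0%N _ f)) // AS0 ZS1 (S_recl (A f)) ZS0 !S1 S2 .
  by rewrite !AS1; ring.
- rewrite S_recl (A_lin (IH 1%N _ f)) // (S_recl (A f)) ZS2 AS2.
  by rewrite (S2 (A f)) (S2 (Z f)); ring.
- have IH0 := IH m (leqW (leqnSn _)) f; have IH1 := IH m.+1 (leqnSn _) f.
  have IH2 := IH m.+2 (leqnn _) f.
  rewrite S_recl (A_lin IH2) (Z_lin IH0) [in LHS]IH1 (S_recl (A f) m.+2).
  by rewrite (S_recl (Z f) m) (S_recl f m.+1); ring.
Qed.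

End TwoSidedRecurrence.

(** * Recurrences for regular undirected degree *)

Section Recurrences.
Variables (G : mixedGraph) (r : nat).
Hypothesis undirected_regular : forall v : G, undirected_degree v = r.
Implicit Types (f g : G -> int) (u v x y : G).

Lemma edge_sum_const c u : edge_sum (fun=> c) u = r%:R * c :> int.
Proof.
rewrite /edge_sum sumr_const -(undirected_regular u) /undirected_degree.
by rewrite cardsE mulr_natl.
Qed.

Lemma arc_sum_lin f f1 f2 f3 c :
    (forall y, f y = f1 y - c * f2 y - f3 y) ->
  forall u, arc_sum f u = arc_sum f1 u - c * arc_sum f2 u - arc_sum f3 u.
Proof.
move=> fE u; rewrite /arc_sum.
by under eq_bigr do rewrite fE; rewrite !sumrB -mulr_sumr.
Qed.

Lemma step_sum_lin f f1 f2 f3 c :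
    (forall y, f y = f1 y - c * f2 y - f3 y) ->
  forall u, step_sum f u = step_sum f1 u - c * step_sum f2 u - step_sum f3 u.
Proof.
move=> fE u; rewrite /step_sum (arc_sum_lin fE) /edge_sum.
by under eq_bigr do rewrite fE; rewrite !sumrB -mulr_sumr; ring.
Qed.

Lemma ball_sum1 f u : ball_sum f 1 u = f u + step_sum f u.
Proof. by rewrite nb_sum_split -addrA. Qed.

Lemma ball_sum2 f u :
  ball_sum f 2 u = f u + step_sum (ball_sum f 1) u - r%:R * f u.
Proof.
rewrite nb_sum_split (eq_bigr (fun y => ball_sum f 1 y - f u)).
  rewrite sumrB -/(edge_sum _ u) -[X in _ - X]/(edge_sum (fun=> f u) u).
  by rewrite edge_sum_const /step_sum; ring.
move=> y uy; have yu : edge y u by rewrite edge_sym.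
by have := ball_sum_edge f 0 yu; rewrite -[nb_sum f 0 y u]/(f u) => ->; ring.
Qed.

(** Walks starting with the edge to [y] continue as all those from [y] except the ones returning at
    once ([edgesE]); [backE] counts these by the same exclusion at [u], and the rest is an instance
    of [nb_sum_split]. *)
Lemma ball_sum_recl f m u :
  ball_sum f m.+3 u = step_sum (ball_sum f m.+2) u
    - (r%:R - 1) * ball_sum f m.+1 u - arc_sum (ball_sum f m) u.
Proof.
have edgesE j : \sum_(y | edge u y) nb_sum f j.+1 u y
    = edge_sum (ball_sum f j.+1) u - \sum_(y | edge u y) nb_sum f j y u.
  rewrite -sumrB; apply: eq_bigr => y uy.
  have yu : edge y u by rewrite edge_sym.
  by have := ball_sum_edge f j yu => ->; ring.
have backE : \sum_(y | edge u y) nb_sum f m.+1 y u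
    = r%:R * ball_sum f m.+1 u - \sum_(y | edge u y) nb_sum f m u y.
  rewrite -(edge_sum_const _ u) -sumrB; apply: eq_bigr => y uy.
  by have := ball_sum_edge f m uy => ->; ring.
rewrite (nb_sum_split f m.+2) edgesE backE (nb_sum_split f m) /step_sum.
ring.
Qed.

Lemma ball_sum_recr f m u :
  ball_sum f m.+3 u = ball_sum (step_sum f) m.+2 u
    - (r%:R - 1) * ball_sum f m.+1 u - ball_sum (arc_sum f) m u.
Proof.
apply: (two_sided_recurrence (S := fun m f => ball_sum f m)) => //.
- exact: step_sum_lin.
- exact: arc_sum_lin.
- exact: ball_sum1.
- exact: ball_sum2.
- by move=> g j w; apply: ball_sum_recl.
Qed.

Lemma step_ball_commutator f m u :
  step_sum (ball_sum f m.+2) u - ball_sum (step_sum f) m.+2 u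
  = arc_sum (ball_sum f m) u - ball_sum (arc_sum f) m u.
Proof. by have := ball_sum_recl f m u; rewrite ball_sum_recr; lia. Qed.

End Recurrences.

(* Numbers of nonbacktracking walks of length at most [m] in a totally regular
   mixed graph: all those from a given vertex, then only those whose first step
   avoids a given edge. *)
Fixpoint moore_counts (r z : int) (m : nat) : int * int :=
  if m is m'.+1 then
    let: (c, a) := moore_counts r z m' in
    (1 + r * a + z * c, 1 + (r - 1) * a + z * c)
  else (1, 1).

Definition moore_ball r z m := (moore_counts r z m).1.
Definition moore_branch r z m := (moore_counts r z m).2.

Lemma moore_ballS r z m :
  moore_ball r z m.+1 = 1 + r * moore_branch r z m + z * moore_ball r z m.
Proof. by rewrite /moore_ball /moore_branch /=; case: moore_counts. Qed.

Lemma moore_branchS r z m : moore_branch r z m.+1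
  = 1 + (r - 1) * moore_branch r z m + z * moore_ball r z m.
Proof. by rewrite /moore_ball /moore_branch /=; case: moore_counts. Qed.

(** Eliminating the branches leaves a recurrence for the balls alone. *)
Lemma moore_ballSS r z m : moore_ball r z m.+2
  = (r + z - 1) * moore_ball r z m.+1 + z * moore_ball r z m + 2.
Proof.
rewrite (moore_ballS _ _ m.+1) moore_branchS (moore_ballS _ _ m); ring.
Qed.

Lemma moore_counts_ge1 (r z : int) m : 1 <= r -> 0 <= z ->
  1 <= moore_ball r z m /\ 1 <= moore_branch r z m.
Proof.
move=> r1 z0; elim: m => [//|m [IHc IHa]].
by rewrite moore_ballS moore_branchS; split; nia.
Qed.

(** * Numbers of walks, and paths from the diameter *)

Section Counting.
Variable G : mixedGraph.
Implicit Types (f : G -> int) (u v x y : G).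

Lemma card_edge_but u x : edge u x ->
  #|[pred y | edge u y && (y != x)]| = (undirected_degree u).-1.
Proof.
move=> ux; rewrite /undirected_degree cardsE [in RHS](cardD1 x).
have -> : x \in edge u by [].
rewrite add1n /=; apply: eq_card => y.
by rewrite !inE andbC.
Qed.

Lemma nb_sum1_le (r z : nat) m :
    (1 <= r)%N -> (forall v : G, undirected_degree v <= r)%N ->
    (forall v : G, directed_outdegree v <= z)%N ->
  (forall u, ball_sum (fun=> 1) m u <= moore_ball r%:R z%:R m) /\
  (forall x u, edge u x -> nb_sum (fun=> 1) m x u <= moore_branch r%:R z%:R m).
Proof.
move=> r1 Er Az; elim: m => [|m [IHc IHa]]; first by split.
have r1' : 1 <= r%:R :> int by rewrite ler1n.
have z0 : 0 <= z%:R :> int by rewrite ler0n.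
have [c1 a1] := moore_counts_ge1 m r1' z0.
have arcs_le u : \sum_(y | arc u y) nb_sum (fun=> 1) m y y
    <= z%:R * moore_ball r%:R z%:R m.
  apply: le_trans (ler_sum _ (fun y _ => IHc y)) _.
  rewrite sumr_const -[leLHS]mulr_natl ler_wpM2r //; first by lia.
  by rewrite ler_nat -cardsE Az.
split=> [u|x u ux].
  rewrite nb_sum_split moore_ballS lerD //; last exact: arcs_le.
  rewrite lerD //.
  have ler_edge y : edge u y ->
    nb_sum (fun=> 1) m u y <= moore_branch r%:R z%:R m.
    by move=> uy; apply: IHa; rewrite edge_sym.
  apply: le_trans (ler_sum _ ler_edge) _.
  rewrite sumr_const -[leLHS]mulr_natl ler_wpM2r //; first by lia.
  by rewrite ler_nat -cardsE Er.
rewrite moore_branchS [leLHS]/= !lerD //.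
have ler_edge y : edge u y && (y != x) ->
  nb_sum (fun=> 1) m u y <= moore_branch r%:R z%:R m.
  by move=> /andP[uy _]; apply: IHa; rewrite edge_sym.
apply: le_trans (ler_sum _ ler_edge) _.
rewrite sumr_const card_edge_but // -[leLHS]mulr_natl.
rewrite ler_wpM2r //; first by lia.
by have := Er u; lia.
Qed.

Lemma nb_sum1_regular (r z : nat) m :
    (forall v : G, undirected_degree v = r) ->
    (forall v : G, directed_outdegree v = z) ->
  (forall u, ball_sum (fun=> 1) m u = moore_ball r%:R z%:R m) /\
  (forall x u, edge u x -> nb_sum (fun=> 1) m x u = moore_branch r%:R z%:R m).
Proof.
move=> Er Az; elim: m => [|m [IHc IHa]]; first by split.
have ballE u : ball_sum (fun=> 1) m.+1 u = moore_ball r%:R z%:R m.+1.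
  rewrite nb_sum_split moore_ballS; congr (_ + _ + _).
    rewrite (eq_bigr (fun=> moore_branch r%:R z%:R m)); last first.
      by move=> y uy; apply: IHa; rewrite edge_sym.
    exact: edge_sum_const.
  rewrite /arc_sum (eq_bigr (fun=> moore_ball r%:R z%:R m)) //.
  by rewrite sumr_const -cardsE -/(directed_outdegree u) Az mulr_natl.
split=> // x u ux.
have := ball_sum_edge (fun=> 1) m ux.
rewrite ballE IHa; last by rewrite edge_sym.
by rewrite moore_ballS moore_branchS; lia.
Qed.

(** A path never turns back along an edge, so it is one of the walks counted. The induction excludes
    [x] from all of [p], which distinctness of the vertices provides at the next step. *)
Lemma nb_sum_path m p x u : path (@step G) u p -> uniq (u :: p) ->
    x \notin p -> (size p <= m)%N ->
  1 <= nb_sum (delta (last u p)) m x u.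
Proof.
have delta_ge0 v w : 0 <= delta v w :> int by apply: ler0n.
have sum_ge1 (P : pred G) (F : G -> int) y : P y -> (forall w, 0 <= F w) ->
    1 <= F y -> 1 <= \sum_(w | P w) F w.
  move=> Py F0 Fy; rewrite (bigD1 y) //=.
  by rewrite (le_trans Fy) // lerDl sumr_ge0.
elim: p m x u => [|y p IHp] m x u /=.
  move=> _ _ _ _; have : 1 <= delta u u :> int by rewrite /delta eqxx.
  case: m => [//|m] u1; rewrite (le_trans u1) //= -addrA lerDl.
  by rewrite addr_ge0 // sumr_ge0 // => w _; apply: nb_sum_ge0.
case: m => [//|m] /andP[uy yp] /and3P[uyp yNp p_uniq].
rewrite inE negb_or ltnS => /andP[x_y xp] pm.
have [uNy uNp] : u != y /\ u \notin p.
  by move: uyp; rewrite inE negb_or => /andP.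
have nb_ge0 x' u' : 0 <= nb_sum (delta (last y p)) m x' u'.
  exact: nb_sum_ge0.
case/orP: uy => uy /=.
  rewrite -addrA [leRHS]addrCA.
  rewrite (le_trans (y := \sum_(y' | edge u y' && (y' != x))
    nb_sum (delta (last y p)) m u y')) //.
    apply: (sum_ge1 _ _ y) => //; first by rewrite uy eq_sym.
    by apply: IHp => //=; rewrite yNp.
  by rewrite lerDl addr_ge0 // sumr_ge0.
rewrite /= (le_trans (y := \sum_(y' | arc u y')
  nb_sum (delta (last y p)) m y' y')) //.
  apply: (sum_ge1 _ (fun y' => nb_sum (delta (last y p)) m y' y') y) => //.
  by apply: IHp => //=; rewrite yNp.
by rewrite lerDr addr_ge0 // sumr_ge0.
Qed.

Lemma diameter_path k u v : diameter G = (k%:Z)%:E ->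
  exists2 p : seq G, is_path u v p & (size p <= k)%N.
Proof.
move=> diamG; have : (distance u v <= (k%:Z)%:E)%O.
  by rewrite -diamG (le_bigmax _ (fun uv : G * G => distance uv.1 uv.2) (u, v)).
case: (pickP [pred p : {bseq #|G| of G} | is_path u v p && (size p <= k)%N]).
  by move=> p /andP[? ?] _; exists p.
(* Otherwise all terms of the minimum exceed [k], and so does its default value [+oo]. *)
move=> no_path; rewrite leNgt => /negP[]; apply: lt_bigmin; first exact: ltry.
move=> p uvp; have := no_path p; rewrite /= uvp /= => /negbT.
by rewrite -ltnNge lte_fin ltz_nat.
Qed.

Lemma ball_sum_delta_ge1 k u v : diameter G = (k%:Z)%:E ->
  1 <= ball_sum (delta v) k u.
Proof.
move=> /(diameter_path u v)[p /andP[/andP[up /eqP <-] up_uniq] pk].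
by apply: nb_sum_path => //; case/andP: up_uniq.
Qed.

End Counting.

(** * The mixed Moore bound *)

Section MooreBoundRecurrence.
Variables (R : realType) (r z : nat).
Hypotheses (r_gt0 : (0 < r)%N) (z_gt0 : (0 < z)%N).

(* [u1] and [u2] are the roots of [X^2 - (r + z - 1) X - z], the characteristic
   polynomial of [moore_ballSS]. *)
Lemma mixed_moore_boundE k :
  mixed_moore_bound R r z k = (moore_ball r%:R z%:R k)%:~R.
Proof.
have r1 : 1 <= r%:R :> R by rewrite ler1n.
have z1 : 1 <= z%:R :> R by rewrite ler1n.
rewrite /mixed_moore_bound /moore_A /moore_B.
set w := moore_w R r z; set s := Num.sqrt w.
have wE : w = (z%:R + r%:R - 1) ^+ 2 + 4 * z%:R by rewrite /w /moore_w; ring.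
have w_gt : (z%:R + r%:R - 1) ^+ 2 < w by rewrite wE; lra.
have w_ge0 : 0 <= w by apply: le_trans (ltW w_gt); apply: sqr_ge0.
have ss : s * s = (z%:R + r%:R - 1) ^+ 2 + 4 * z%:R.
  by rewrite -expr2 sqr_sqrtr.
have s_gt : z%:R + r%:R - 1 < s.
  rewrite -(@ltr_pXn2r _ 2) ?nnegrE ?sqrtr_ge0 ?sqr_sqrtr //; lra.
have s_neq0 : s != 0 by apply: lt0r_neq0; lra.
set u1 := moore_u1 R r z; set u2 := moore_u2 R r z.
have u1E : u1 = (z%:R + r%:R - 1 - s) / 2 by [].
have u2E : u2 = (z%:R + r%:R - 1 + s) / 2 by [].
set A := (s - _) / _; set B := (s + _) / _.
(* [A * u1 ^+ i + B * u2 ^+ i] is the number of walks of length exactly [i]; these are its values at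
   0 and 1. *)
have AB1 : A + B = 1 by rewrite /A /B; field.
have ABu : A * u1 + B * u2 = z%:R + r%:R by rewrite /A /B u1E u2E; field.
have u1_sqr : u1 * u1 = (z%:R + r%:R - 1) * u1 + z%:R by rewrite u1E; nra.
have u2_sqr : u2 * u2 = (z%:R + r%:R - 1) * u2 + z%:R by rewrite u2E; nra.
have u1_neq1 : u1 - 1 != 0 by apply: ltr0_neq0; rewrite u1E; lra.
have u2_neq1 : u2 - 1 != 0 by apply: lt0r_neq0; rewrite u2E; lra.
have geomS (u : R) m : u - 1 != 0 ->
    (u ^+ m.+2 - 1) / (u - 1) = 1 + u * ((u ^+ m.+1 - 1) / (u - 1)).
  by move=> u1_; rewrite (exprS u m.+1); field.
have geom0 (u : R) : u - 1 != 0 -> (u ^+ 1 - 1) / (u - 1) = 1.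
  by move=> u1_; rewrite expr1 divff.
elim/ltn_ind: k => -[|[|k]] IHk.
- by rewrite !geom0 // !mulr1 AB1.
- rewrite !geomS // !geom0 // !mulr1 !mulrDr !mulr1 addrACA AB1 ABu.
  by rewrite /moore_ball /= !mulr1 !rmorphD /= !rmorph_nat; ring.
have IH0 := IHk k (leqW (leqnn _)); have IH1 := IHk k.+1 (leqnn _).
move: IH0 IH1; rewrite moore_ballSS !geomS //.
set g1 := (u1 ^+ k.+1 - 1) / _; set g2 := (u2 ^+ k.+1 - 1) / _.
rewrite !rmorphD !rmorphM !rmorphB !rmorphD /= !rmorph_nat => <- <-.
have -> : A * (1 + u1 * (1 + u1 * g1)) + B * (1 + u2 * (1 + u2 * g2))
    = (A + B) + (A * u1 + B * u2) + A * (u1 * u1) * g1 + B * (u2 * u2) * g2.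
  by ring.
rewrite u1_sqr u2_sqr.
have -> : (r%:R + z%:R - 1%:~R) * (A * (1 + u1 * g1) + B * (1 + u2 * g2))
    = (r%:R + z%:R - 1) * (A + B)
      + (r%:R + z%:R - 1) * (A * (u1 * g1) + B * (u2 * g2)).
  by ring.
by rewrite AB1 ABu; ring.
Qed.

End MooreBoundRecurrence.

(** * Regularity and the repeated vertex *)

Section DefectOne.
Variables (R : realType) (r z k : nat) (G : mixedGraph).
Hypotheses (r_gt0 : (0 < r)%N) (z_gt0 : (0 < z)%N) (k_gt1 : (1 < k)%N).
Hypothesis defectG : defect_graph R r z k 1 G.
Implicit Types u v : G.

Lemma defect1_card : #|G|%:R = moore_ball r%:R z%:R k - 1 :> int.
Proof.
have [_ _ _ cardG] := defectG.
apply: (@intr_inj R); by rewrite rmorphB rmorph_nat cardG mixed_moore_boundE.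
Qed.

Lemma ball_sum_total m u :
  ball_sum (fun=> 1) m u = \sum_v ball_sum (delta v) m u.
Proof.
by rewrite /ball_sum nb_sumE; apply: eq_bigr => v _; rewrite mul1r.
Qed.

Lemma card_le_ball u : #|G|%:R <= ball_sum (fun=> 1) k u.
Proof.
have [diamG _ _ _] := defectG.
rewrite ball_sum_total -sum1_card natr_sum; apply: ler_sum => v _.
exact: ball_sum_delta_ge1.
Qed.

Lemma undirected_degree_le u : (undirected_degree u <= r)%N.
Proof. by have [_ <- _ _] := defectG; apply: leq_bigmax. Qed.

Lemma directed_outdegree_le u : (directed_outdegree u <= z)%N.
Proof. by have [_ _ <- _] := defectG; apply: leq_bigmax. Qed.

(* A vertex of too small a degree would reach too few vertices. *)
Lemma defect1_regular u :
  undirected_degree u = r /\ directed_outdegree u = z.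
Proof.
have r1 : 1 <= r%:R :> int by rewrite ler1n.
have z1 : 1 <= z%:R :> int by rewrite ler1n.
have z0 : 0 <= z%:R :> int by lia.
case: k k_gt1 card_le_ball defect1_card => [//|[//|m]] _ /(_ u) card_le cardE.
have [c_le a_le] :=
  nb_sum1_le m.+1 r_gt0 undirected_degree_le directed_outdegree_le.
have [c1 a1] := moore_counts_ge1 m r1 z0.
have [c2 a2] := moore_counts_ge1 m.+1 r1 z0.
(* A missing edge or arc at [u] thus costs at least 2 walks, while the order is only 1 below the
   bound. *)
have a_ge2 : 2 <= moore_branch r%:R z%:R m.+1 by rewrite moore_branchS; nia.
have c_ge2 : 2 <= moore_ball r%:R z%:R m.+1 by rewrite moore_ballS; nia.
have Eu := undirected_degree_le u; have Au := directed_outdegree_le u.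
have ball_le : ball_sum (fun=> 1) m.+2 u
    <= 1 + (undirected_degree u)%:R * moore_branch r%:R z%:R m.+1
         + (directed_outdegree u)%:R * moore_ball r%:R z%:R m.+1.
  rewrite nb_sum_split lerD //.
    rewrite lerD // /undirected_degree cardsE mulr_natl -sumr_const.
    by apply: ler_sum => y uy; apply: a_le; rewrite edge_sym.
  rewrite /directed_outdegree cardsE mulr_natl -sumr_const.
  by apply: ler_sum => y _; apply: c_le.
move: cardE; rewrite moore_ballS => cardE.
move: (moore_branch _ _ _) (moore_ball _ _ _) a_ge2 c_ge2 ball_le cardE.
move=> a c a_ge2 c_ge2 ball_le cardE.
have Eu' : (undirected_degree u)%:R <= r%:R :> int by rewrite ler_nat.
have Au' : (directed_outdegree u)%:R <= z%:R :> int by rewrite ler_nat.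
split; apply/eqP; rewrite eqn_leq ?Eu ?Au /= leqNgt; apply/negP => lt_deg.
  have : (undirected_degree u)%:R + 1 <= r%:R :> int by rewrite natr1 ler_nat.
  nia.
have : (directed_outdegree u)%:R + 1 <= z%:R :> int by rewrite natr1 ler_nat.
nia.
Qed.

(* [rho u] is the only vertex reached from [u] by two walks. *)
Lemma defect1_repeat : exists rho : G -> G,
  forall u v, ball_sum (delta v) k u = 1 + delta v (rho u).
Proof.
have [diamG _ _ _] := defectG.
suff repeat u : exists w, forall v, ball_sum (delta v) k u = 1 + delta v w.
  by have [rho rhoP] := fin_all_exists repeat; exists rho.
have ge1 v : 1 <= ball_sum (delta v) k u by apply: ball_sum_delta_ge1.
(* The walks outnumber the vertices by 1, so exactly one of these nonnegative terms is nonzero. *)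
have sumE : \sum_v (ball_sum (delta v) k u - 1) = 1.
  have [total _] := nb_sum1_regular k (fun v => (defect1_regular v).1)
    (fun v => (defect1_regular v).2).
  rewrite sumrB -ball_sum_total total sumr_const.
  by rewrite -[X in _ - X]/(#|G|%:R) defect1_card; ring.
case: (pickP (fun w => ball_sum (delta w) k u - 1 != 0)) => [w w_neq0|all0].
  have rest_ge0 (v : G) : v != w -> 0 <= ball_sum (delta v) k u - 1.
    by move=> _; have := ge1 v; lia.
  move: sumE; rewrite (bigD1 w) //= => sumE.
  have rest0 : \sum_(v | v != w) (ball_sum (delta v) k u - 1) = 0.
    have w_ge2 : 1 <= ball_sum (delta w) k u - 1 by have := ge1 w; lia.
    apply/eqP; rewrite eq_le sumr_ge0 // andbT.
    by rewrite -(lerD2l (ball_sum (delta w) k u - 1)) sumE addr0.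
  exists w => v; rewrite [delta v w]/delta; case: eqVneq => [<-|wv] /=.
    by move: sumE; rewrite rest0; lia.
  by have /(_ v) := psumr_eq0P rest_ge0 rest0; rewrite eq_sym => /(_ wv); lia.
by move: sumE; rewrite big1 // => v _; apply/eqP; rewrite -[_ == _]negbK all0.
Qed.

End DefectOne.

(** * Comparing the two ends of an edge *)

Section RepeatCommutator.
Variables (G : mixedGraph) (r z m : nat) (rho : G -> G).
Hypothesis undirected_regular : forall v : G, undirected_degree v = r.
Hypothesis directed_regular : forall v : G, directed_outdegree v = z.
Hypothesis rhoP :
  forall u v, ball_sum (delta v) m.+4 u = 1 + delta v (rho u).
Implicit Types (f : G -> int) (u v x y : G).

Lemma arc_sum_const c u : arc_sum (fun=> c) u = z%:R * c :> int.
Proof.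
rewrite /arc_sum sumr_const -(directed_regular u) /directed_outdegree.
by rewrite cardsE mulr_natl.
Qed.

Lemma step_sum_const c u : step_sum (fun=> c) u = (r + z)%:R * c :> int.
Proof.
rewrite /step_sum (edge_sum_const undirected_regular) arc_sum_const natrD.
by ring.
Qed.

Lemma ball_sum_repeat f u : ball_sum f m.+4 u = \sum_v f v + f (rho u).
Proof.
rewrite /ball_sum nb_sumE -(sum_delta f (rho u)) -big_split.
apply: eq_bigr => v _.
rewrite -[nb_sum _ _ _ _]/(ball_sum (delta v) m.+4 u) rhoP.
by rewrite /= /delta eq_sym; ring.
Qed.

(** Row [u] of the commutator of [A] with the matrix of [rho], applied to [f]. *)
Definition repeat_gap f u :=
  step_sum (fun y => f (rho y)) u - step_sum f (rho u).

(** The parenthesis is the contribution of [J]. It reflects the in-degrees and does not depend on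
    [u], so it cancels between two vertices. *)
Lemma repeat_commutator f u :
  repeat_gap f u + ((r + z)%:R * \sum_v f v - \sum_v step_sum f v)
  = arc_sum (ball_sum f m.+2) u - ball_sum (arc_sum f) m.+2 u.
Proof.
rewrite -(step_ball_commutator undirected_regular) ball_sum_repeat.
rewrite (@step_sum_lin _ _ (fun y => f (rho y)) (fun=> \sum_v f v)
  (fun=> 0) (-1)) => [|y]; last by rewrite ball_sum_repeat; ring.
by rewrite !step_sum_const /repeat_gap; ring.
Qed.

(* Cancelling the terms which agree at both ends of the edge [u u'], the right
   hand side of [repeat_commutator] at [u] minus that at [u'] is a difference of
   two nonnegative parts: this one, and the same with [u] and [u'] exchanged. *)
Definition edge_excess f u u' :=
  arc_sum (fun y => ball_sum f m.+2 y
    - (ball_sum (arc_sum f) m.+1 y - ball_sum (arc_sum f) m y)) u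
  + \sum_(b | edge u' b && (b != u))
      (nb_sum (arc_sum f) m.+1 u' b - nb_sum (arc_sum f) m u' b).

(** Both sides sum over the walks of length exactly [j + 2], on the right by their first step. *)
Lemma nb_sum_increment f j x u :
  nb_sum f j.+2 x u - nb_sum f j.+1 x u
  = \sum_(b | edge u b && (b != x)) (nb_sum f j.+1 u b - nb_sum f j u b)
    + arc_sum (fun y => ball_sum f j.+1 y - ball_sum f j y) u.
Proof.
rewrite /arc_sum !sumrB -[nb_sum f j.+2 x u]/(f u
  + \sum_(y | edge u y && (y != x)) nb_sum f j.+1 u y
  + \sum_(y | arc u y) nb_sum f j.+1 y y).
rewrite -[nb_sum f j.+1 x u]/(f u
  + \sum_(y | edge u y && (y != x)) nb_sum f j u y
  + \sum_(y | arc u y) nb_sum f j y y).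
rewrite /ball_sum; ring.
Qed.

(** Splitting both balls of [arc_sum f] along the edge turns their difference into the increments of
    [nb_sum] at [u] and at [u'], which [nb_sum_increment] expands. *)
Lemma edge_excessB f u u' : edge u u' ->
  edge_excess f u u' - edge_excess f u' u = repeat_gap f u - repeat_gap f u'.
Proof.
move=> uu'; have u'u : edge u' u by rewrite edge_sym.
have arcE w : arc_sum (fun y => ball_sum f m.+2 y
    - (ball_sum (arc_sum f) m.+1 y - ball_sum (arc_sum f) m y)) w
  = arc_sum (ball_sum f m.+2) w
    - arc_sum (fun y =>
        ball_sum (arc_sum f) m.+1 y - ball_sum (arc_sum f) m y) w.
  by rewrite /arc_sum -sumrB.
have incr := nb_sum_increment (arc_sum f) m u' u.
have incr' := nb_sum_increment (arc_sum f) m u u'.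
have gap := repeat_commutator f u; have gap' := repeat_commutator f u'.
have edgeE := ball_sum_edge (arc_sum f) m.+1 uu'.
have edgeE' := ball_sum_edge (arc_sum f) m.+1 u'u.
rewrite /edge_excess !arcE.
move: incr incr' gap gap'; rewrite edgeE edgeE'.
set s := \sum_(b | edge u b && _) _; set s' := \sum_(b | edge u' b && _) _.
set t := arc_sum (fun y => _) u; set t' := arc_sum (fun y => _) u'.
set n := nb_sum _ _ _ _; set n1 := nb_sum _ _ _ _.
set n' := nb_sum _ m.+2 u u'; set n1' := nb_sum _ m.+1 u u'.
set p := arc_sum _ u; set p' := arc_sum _ u'.
set q := repeat_gap f u; set q' := repeat_gap f u'; set K := _ * _ - _.
move: s s' t t' n n1 n' n1' p p' q q' K; clear; lia.
Qed.

Lemma edge_excess_ge0 f u u' : (forall w, 0 <= f w) -> 0 <= edge_excess f u u'.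
Proof.
move=> f_ge0; have arc_ge0 w : 0 <= arc_sum f w by apply: arc_sum_ge0.
apply: addr_ge0; apply: sumr_ge0 => y _; last by rewrite subr_ge0 leS_nb_sum.
have := nb_sum_arc_le m.+1 y y f_ge0; have := f_ge0 y.
have := nb_sum_ge0 m y y arc_ge0; rewrite /ball_sum; lia.
Qed.

(* The walks counted on the left, the second ones preceded by the edge [u u'],
   are distinct walks from [u]. *)
Lemma edge_excess_le f u u' : edge u u' -> (forall w, 0 <= f w) ->
  edge_excess f u u' + edge_excess f u' u <= ball_sum f m.+4 u.
Proof.
move=> uu' f_ge0; have arc_ge0 w : 0 <= arc_sum f w by apply: arc_sum_ge0.
(* The slack [j] is 1 at [u] and 0 at [u'], where the edge has already used one step. *)
have arcs_le j w :
    arc_sum (fun y => ball_sum f m.+2 y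
    - (ball_sum (arc_sum f) m.+1 y - ball_sum (arc_sum f) m y)) w
    <= arc_sum (ball_sum f (j + m.+2)) w.
  apply: ler_sum => y _; apply: (le_trans (y := ball_sum f m.+2 y)).
    by rewrite lerBlDr lerDl subr_ge0 leS_nb_sum.
  elim: j => [//|j IHj]; apply: le_trans IHj _.
  exact: leS_nb_sum.
have edges_le j w w' :
    \sum_(b | edge w' b && (b != w))
      (nb_sum (arc_sum f) m.+1 w' b - nb_sum (arc_sum f) m w' b)
    <= \sum_(b | edge w' b && (b != w)) nb_sum f (j + m.+2) w' b.
  apply: ler_sum => y _; apply: (le_trans (y := nb_sum f m.+2 w' y)).
    have := nb_sum_arc_le m.+1 w' y f_ge0; have := f_ge0 y.
    by have := nb_sum_ge0 m w' y arc_ge0; lia.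
  elim: j => [//|j IHj]; apply: le_trans IHj _.
  exact: leS_nb_sum.
rewrite (ball_sum_edge f m.+3 uu').
have a1 := arcs_le 1%N u; have a2 := arcs_le 0%N u'.
have e1 := edges_le 0%N u u'; have e2 := edges_le 1%N u' u.
have f1 := f_ge0 u; have f2 := f_ge0 u'.
rewrite /edge_excess -[nb_sum f m.+4 u' u]/(f u
  + \sum_(y | edge u y && (y != u')) nb_sum f m.+3 u y
  + \sum_(y | arc u y) nb_sum f m.+3 y y).
rewrite -[nb_sum f m.+3 u u']/(f u'
  + \sum_(y | edge u' y && (y != u)) nb_sum f m.+2 u' y
  + \sum_(y | arc u' y) nb_sum f m.+2 y y).
move: a1 a2 e1 e2 f1 f2; rewrite add0n add1n /arc_sum /ball_sum; clear.
move: (\sum_(y | arc u y) nb_sum f m.+3 y y); lia.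
Qed.

End RepeatCommutator.

(** * Summing the excess over all vertices *)

Section ExcessCount.
Variables (G : mixedGraph) (r z m : nat) (rho : G -> G).
Hypotheses (r_gt0 : (0 < r)%N) (z_gt0 : (0 < z)%N).
Hypothesis undirected_regular : forall v : G, undirected_degree v = r.
Hypothesis directed_regular : forall v : G, directed_outdegree v = z.
Hypothesis rhoP :
  forall u v, ball_sum (delta v) m.+4 u = 1 + delta v (rho u).
Implicit Types (f : G -> int) (u v x y : G).

Let ball := moore_ball r%:R z%:R.

Lemma sum_ball_delta j u : \sum_(v : G) ball_sum (delta v) j u = ball j.
Proof.
have [total _] := nb_sum1_regular j undirected_regular directed_regular.
by rewrite -ball_sum_total total.
Qed.

Lemma sum_arc_delta w : \sum_(v : G) arc_sum (delta v) w = z%:R.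
Proof.
rewrite /arc_sum exchange_big (eq_bigr (fun=> 1)) => [|y _].
  rewrite -[LHS]/(arc_sum (fun=> 1) w).
  by rewrite (arc_sum_const directed_regular) mulr1.
exact: sum_delta1.
Qed.

Lemma sum_ball_arc_delta j u :
  \sum_(v : G) ball_sum (arc_sum (delta v)) j u = z%:R * ball j.
Proof.
have [total _] := nb_sum1_regular j undirected_regular directed_regular.
rewrite /ball -(total u) /ball_sum -nb_sumZ -nb_sum_sum; apply: eq_nb_sum => w.
by rewrite sum_arc_delta mulr1.
Qed.

(** Only the arcs at [u] are kept; the other edges at [u'] contribute a nonnegative sum. *)
Lemma sum_edge_excess u u' : edge u u' ->
  z%:R * (ball m.+2 - z%:R * (ball m.+1 - ball m))
  <= \sum_(v : G) edge_excess m (delta v) u u'.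
Proof.
move=> uu'; rewrite /edge_excess big_split /=.
have -> : \sum_(v : G) arc_sum (fun y => ball_sum (delta v) m.+2 y
    - (ball_sum (arc_sum (delta v)) m.+1 y
       - ball_sum (arc_sum (delta v)) m y)) u
    = z%:R * (ball m.+2 - z%:R * (ball m.+1 - ball m)).
  rewrite -(arc_sum_const directed_regular _ u) /arc_sum exchange_big.
  apply: eq_bigr => y _; rewrite !sumrB sum_ball_delta.
  by rewrite !sum_ball_arc_delta; ring.
rewrite lerDl sumr_ge0 // => v _; rewrite sumr_ge0 // => b _.
rewrite subr_ge0 leS_nb_sum // => w; apply: arc_sum_ge0 => y; exact: ler0n.
Qed.

Lemma sum_step_delta (g : G -> G) u :
  \sum_(v : G) step_sum (fun y => delta v (g y)) u = (r + z)%:R.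
Proof.
rewrite -[RHS]mulr1.
rewrite -(step_sum_const undirected_regular directed_regular 1 u).
rewrite /step_sum /edge_sum /arc_sum big_split /=; congr (_ + _);
  rewrite exchange_big; apply: eq_bigr => y _; exact: sum_delta1.
Qed.

Lemma step_sum_ge0 f u : (forall w, 0 <= f w) -> 0 <= step_sum f u.
Proof. by move=> f_ge0; rewrite addr_ge0 ?sumr_ge0. Qed.

(** For [v] other than [rho u] the two excesses add up to at most 1, so one vanishes and their sum
    is the absolute value of their difference, at most four step sums. At [rho u] the sum is at most
    2. Summing over [v] gives twice the bound. *)
Lemma excess_bound u u' : edge u u' ->
  z%:R * (ball m.+2 - z%:R * (ball m.+1 - ball m)) <= 2 * (r + z)%:R + 1.
Proof.
move=> uu'; have u'u : edge u' u by rewrite edge_sym.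
have delta0 v w : 0 <= delta v w :> int by apply: ler0n.
have pointwise v : edge_excess m (delta v) u u' + edge_excess m (delta v) u' u
    <= step_sum (fun y => delta v (rho y)) u + step_sum (delta v) (rho u)
     + (step_sum (fun y => delta v (rho y)) u' + step_sum (delta v) (rho u'))
     + (delta v (rho u) + delta v (rho u)).
  have := edge_excess_le m uu' (delta0 v).
  have := edge_excess_ge0 m u u' (delta0 v).
  have := edge_excess_ge0 m u' u (delta0 v).
  have := edge_excessB undirected_regular directed_regular rhoP (delta v) uu'.
  have := step_sum_ge0 u (fun y => delta0 v (rho y)).
  have := step_sum_ge0 u' (fun y => delta0 v (rho y)).
  have := step_sum_ge0 (rho u) (delta0 v).
  have := step_sum_ge0 (rho u') (delta0 v).
  rewrite rhoP /repeat_gap.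
  have : delta v (rho u) = 0 \/ delta v (rho u) = 1.
    by rewrite /delta; case: eqP; [right|left].
  move: (delta v (rho u)) (edge_excess _ _ _ _) (edge_excess _ _ u' u).
  move: (step_sum _ (rho u)) (step_sum _ (rho u')).
  move: (step_sum _ _) (step_sum _ u').
  by move=> a b c d e x x' [->|->]; lia.
have sum_le (X X' a b c d e : G -> int) :
    (forall v, X v + X' v <= a v + b v + (c v + d v) + (e v + e v)) ->
    \sum_v X v + \sum_v X' v <= \sum_v a v + \sum_v b v
      + (\sum_v c v + \sum_v d v) + (\sum_v e v + \sum_v e v).
  by move=> le; rewrite -!big_split; apply: ler_sum => v _; apply: le.
have := sum_le _ _ _ _ _ _ _ pointwise.
have stepE w : \sum_(v : G) step_sum (delta v) w = (r + z)%:R.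
  exact: (sum_step_delta (fun y => y) w).
have repeatE w :
    \sum_(v : G) step_sum (fun y => delta v (rho y)) w = (r + z)%:R.
  exact: sum_step_delta.
rewrite !stepE !repeatE !sum_delta1.
have := sum_edge_excess uu'; have := sum_edge_excess u'u.
move: (\sum_(v : G) edge_excess m (delta v) u' u).
move: (\sum_(v : G) edge_excess m (delta v) u u').
by move: (z%:R * _) => p s s'; lia.
Qed.

(** By [moore_ballSS] the left side is [z * ((r - 1) * c' + 2 * z * c + 2)], too large if [r] or [z]
    exceeds 1; otherwise [2 * c + 2 <= 5], which forces [m = 0]. *)
Lemma excess_bound_small u u' : edge u u' -> [/\ r = 1, z = 1 & m = 0]%N.
Proof.
move=> uu'; have := excess_bound uu'; rewrite /ball moore_ballSS.
have r1 : 1 <= r%:R :> int by rewrite ler1n.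
have z1 : 1 <= z%:R :> int by rewrite ler1n.
have z0 : 0 <= z%:R :> int by lia.
have [c1 a1] := moore_counts_ge1 m r1 z0.
have c2 : 1 + r%:R + z%:R <= moore_ball r%:R z%:R m.+1.
  by rewrite moore_ballS; nia.
have cm : (0 < m)%N -> 3 <= moore_ball r%:R z%:R m.
  case: m => [//|j] _; have [c3 a3] := moore_counts_ge1 j r1 z0.
  by rewrite moore_ballS; nia.
move: (moore_ball _ _ m) (moore_ball _ _ m.+1) c1 c2 cm => c c' c1 c2 cm bound.
have bound' : z%:R * ((r%:R - 1) * c' + 2 * z%:R * c + 2)
    <= 2 * (r%:R + z%:R) + 1 :> int.
  by rewrite -natrD; apply: le_trans bound; rewrite le_eqVlt; apply/orP; left;
    apply/eqP; ring.
have r_eq1 : r%:R = 1 :> int.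
  apply: contraTeq bound' => r_neq1; rewrite -ltNge.
  have [s rE s1] : exists2 s, r%:R = s + 1 :> int & 1 <= s.
    by exists (r%:R - 1); [ring | lia].
  rewrite rE in c2 *; move: (z%:R : int) z1 c2 => t t1 c2.
  have sc' : s * (2 + s + t) <= s * c' by apply: ler_wpM2l; lia.
  have ss1 : 1 <= s * s by nia.
  have st1 : t <= s * t by nia.
  have tc1 : t <= t * c by nia.
  have inner : 2 * s + 3 * t + 3 <= (s + 1 - 1) * c' + 2 * t * c + 2 by nia.
  by nia.
have z_eq1 : z%:R = 1 :> int.
  apply: contraTeq bound' => z_neq1; rewrite -ltNge r_eq1.
  have z2 : 2 <= z%:R :> int by lia.
  by move: (z%:R : int) z2 => t t2; nia.
have c_eq1 : c <= 1 by move: bound'; rewrite r_eq1 z_eq1; lia.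
split; [by apply/eqP; rewrite -(eqr_nat int) r_eq1|
  by apply/eqP; rewrite -(eqr_nat int) z_eq1|].
by case: (posnP m) => // /cm; lia.
Qed.

End ExcessCount.

(** * The case r = z = 1, k = 4 *)

Section UnitDegrees.
Variables (G : mixedGraph) (rho : G -> G).
Hypothesis undirected_regular : forall v : G, undirected_degree v = 1%N.
Hypothesis directed_regular : forall v : G, directed_outdegree v = 1%N.
Hypothesis rhoP : forall u v, ball_sum (delta v) 4 u = 1 + delta v (rho u).
Variables e f : G -> G.
Hypothesis edgeE : forall u v, edge u v = (v == e u).
Hypothesis arcE : forall u v, arc u v = (v == f u).
Implicit Types (phi : G -> int) (u v : G).

Let eK : involutive e.
Proof. by move=> u; apply/esym/eqP; rewrite -edgeE edge_sym edgeE. Qed.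

Let e_neq u : e u <> u.
Proof. by move=> eu; have := edge_irr u; rewrite edgeE eu eqxx. Qed.

Let f_neq u : f u <> u.
Proof. by move=> fu; have := arc_irr u; rewrite arcE fu eqxx. Qed.

Let ff_neq u : f (f u) <> u.
Proof.
move=> ffu; have fu : arc u (f u) by rewrite arcE.
by have := arc_asym fu; rewrite arcE ffu eqxx.
Qed.

Let e_neq_f u : e u <> f u.
Proof.
move=> euf; have eu : edge u (e u) by rewrite edgeE.
by have := edge_not_arc eu; rewrite arcE euf eqxx.
Qed.

Let arc_sumE phi u : arc_sum phi u = phi (f u).
Proof. by rewrite /arc_sum (big_pred1 (f u)) // => y; apply: arcE. Qed.

Let edge_sumE phi u : edge_sum phi u = phi (e u).
Proof. by rewrite /edge_sum (big_pred1 (e u)) // => y; apply: edgeE. Qed.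

Let ball_sum1E phi u : ball_sum phi 1 u = phi u + phi (e u) + phi (f u).
Proof. by rewrite ball_sum1 /step_sum edge_sumE arc_sumE addrA. Qed.

(** After the edge to [e u] the next step is an arc, the only edge there leading back. *)
Let ball_sumSS phi m u : ball_sum phi m.+2 u
  = phi u + phi (e u) + ball_sum phi m (f (e u)) + ball_sum phi m.+1 (f u).
Proof.
rewrite nb_sum_split arc_sumE; congr (_ + _); rewrite -addrA; congr (_ + _).
rewrite (big_pred1 (e u)) => [|y]; last exact: edgeE.
rewrite -[nb_sum phi m.+1 u (e u)]/(phi (e u)
  + \sum_(y | edge (e u) y && (y != u)) nb_sum phi m (e u) y
  + arc_sum (ball_sum phi m) (e u)).
rewrite arc_sumE big_pred0 ?addr0 // => y.
by rewrite edgeE eK andbN.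
Qed.

Let ball_sum2E phi u : ball_sum phi 2 u = phi u + phi (e u) + phi (f (e u))
  + (phi (f u) + phi (e (f u)) + phi (f (f u))).
Proof. by rewrite ball_sumSS ball_sum1E. Qed.

(** Ends of eight of the eleven walks of length at most 3. *)
Let walk_ends u := [:: u; e u; f u; f (e u); e (f u); f (f u);
  f (f (e u)); e (f (f u))].

Let walk_ends_le phi u : (forall w, 0 <= phi w) ->
  \sum_(w <- walk_ends u) phi w <= ball_sum phi 4 u.
Proof.
move=> phi_ge0; have le3 : ball_sum phi 3 u <= ball_sum phi 4 u.
  exact: leS_nb_sum.
apply: le_trans le3.
rewrite ball_sumSS ball_sum1E ball_sum2E /walk_ends !big_cons big_nil.
have p1 := phi_ge0 (e (f (e u))); have p2 := phi_ge0 (f (e (f u))).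
by have p3 := phi_ge0 (f (f (f u))); lia.
Qed.

(** Two walks with the same end give a count of at least 2 there, which only [rho u] has. *)
Let collision u i j : (i < j < 8)%N ->
  nth u (walk_ends u) i = nth u (walk_ends u) j ->
  rho u = nth u (walk_ends u) j.
Proof.
move=> /andP[ij j8]; set v := nth u _ j => iv.
have : \sum_(w <- walk_ends u) delta v w <= 1 + delta v (rho u).
  by rewrite -rhoP; apply: walk_ends_le => w; apply: ler0n.
have v_take : v \in take i.+1 (walk_ends u).
  rewrite -iv -(@nth_take i.+1) // mem_nth // size_take.
  by rewrite (_ : size _ = 8) //; case: ifP => _; lia.
have v_drop : v \in drop i.+1 (walk_ends u).
  have -> : v = nth u (drop i.+1 (walk_ends u)) (j - i.+1).
    by rewrite nth_drop subnKC.
  by rewrite mem_nth // size_drop (_ : size _ = 8) //; lia.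
have ge1 s : v \in s -> 1 <= \sum_(w <- s) delta v w :> int.
  move=> vs; rewrite (big_rem v) //= {1}/delta eqxx lerDl.
  by apply: sumr_ge0 => w _; apply: ler0n.
rewrite -{1}(cat_take_drop i.+1 (walk_ends u)) big_cat.
have := ge1 _ v_take; have := ge1 _ v_drop.
case: (eqVneq (rho u) v) => // rv; rewrite [delta v (rho u)]/delta (negPf rv).
by rewrite addr0 => d1 t1 /(le_trans (lerD t1 d1)).
Qed.

(** The case [m = 0] of [repeat_commutator], without the terms common to both sides; [e] is a
    permutation, so only [f] contributes to the difference of sums. *)
Let balance phi u :
  phi (rho (e u)) + phi (rho (f u)) + phi (f (e u)) + phi (f (f (e u)))
  + (\sum_v phi v - \sum_v phi (f v))
  = phi (e (rho u)) + phi (f (rho u)) + phi (e (f u)) + phi (e (f (f u))).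
Proof.
have := repeat_commutator (m := 0) undirected_regular directed_regular
  rhoP phi u.
rewrite /repeat_gap arc_sumE !ball_sum2E /step_sum !edge_sumE !arc_sumE.
have -> : \sum_v (edge_sum phi v + arc_sum phi v)
    = \sum_v phi v + \sum_v phi (f v).
  rewrite big_split /=; congr (_ + _); last first.
    by apply: eq_bigr => v _; apply: arc_sumE.
  rewrite [RHS](reindex_inj (inv_inj eK)); apply: eq_bigr => v _.
  exact: edge_sumE.
move: (\sum_v phi v) (\sum_v phi (f v)) => s s'; lia.
Qed.

Let sum4_neq0 (a b c d : bool) :
  1 <= a%:R + b%:R + c%:R + d%:R :> int -> [\/ a, b, c | d].
Proof.
case: a b c d => [] [] [] [] //= _;
  by [exact: Or41|exact: Or42|exact: Or43|exact: Or44].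
Qed.

(** If [s] is not a value of [f], the difference of sums in [balance] is 1 for [delta s], so some
    term on the right is nonzero at every [u]. *)
Let surjective s : exists u, f u = s.
Proof.
case: (pickP (fun u => f u == s)) => [u /eqP fu|not_f]; first by exists u.
have f_neq_s u : f u <> s by move=> fu; have := not_f u; rewrite fu eqxx.
have fs u : delta s (f u) = 0 by rewrite /delta; have /= -> := not_f u.
have sum_fs : \sum_v delta s (f v) = 0 by rewrite big1.
have sum_s : \sum_v delta s v = 1.
  rewrite -[RHS](sum_delta (fun=> 1) s).
  by apply: eq_bigr => v _; rewrite mul1r.
set t := e s; have et : e t = s by apply: eK.
have near u : [\/ rho u = t, f u = t | f (f u) = t].
  have := balance (delta s) u; rewrite sum_s sum_fs !fs => bal.
  have : 1 <= (e (rho u) == s)%:R + (e (f u) == s)%:R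
      + (e (f (f u)) == s)%:R + false%:R :> int.
    have p1 : 0 <= delta s (rho (e u)) by apply: ler0n.
    have p2 : 0 <= delta s (rho (f u)) by apply: ler0n.
    by move: bal p1 p2; rewrite /delta; lia.
  case/sum4_neq0 => // /eqP sE; rewrite /t -sE eK;
    by [exact: Or31|exact: Or32|exact: Or33].
have rho_t : rho t = t.
  by case: (near t) => // [/f_neq|/ff_neq].
have rho_s : rho s = t.
  case: (near s) => // [fst|ffst]; first by case: (@e_neq_f s).
  by rewrite -ffst; apply: (@collision s 1 5).
(* Subtracting the balances at [s] and [t], the terms left besides that of [rho (f s)] force it to
   be positive. *)
have key x : (f t == x) = false -> (f (f t) == x) = false ->
    (e (f t) == x) = false -> (e (f (f t)) == x) = false ->
    x = f s \/ x = f (f s) -> rho (f s) = x.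
  move=> x1 x2 x3 x4 x5.
  have := balance (delta x) t; have := balance (delta x) s.
  rewrite -/t et rho_t rho_s -/t et.
  rewrite [delta x (f t)]/delta x1 [delta x (f (f t))]/delta x2.
  rewrite [delta x (e (f t))]/delta x3 [delta x (e (f (f t)))]/delta x4.
  move: (_ - _) => K.
  have p1 : 0 <= delta x (f s) by apply: ler0n.
  have p2 : 0 <= delta x (f (f s)) by apply: ler0n.
  have p3 : 0 <= delta x (e (f s)) by apply: ler0n.
  have p4 : 0 <= delta x (e (f (f s))) by apply: ler0n.
  have p5 : 0 <= delta x (rho (f t)) by apply: ler0n.
  have p6 : 1 <= delta x (f s) + delta x (f (f s)).
    by case: x5 p1 p2 => <-; rewrite [delta x x]/delta eqxx; lia.
  case: (eqVneq (rho (f s)) x) => // rx.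
  rewrite [delta x (rho (f s))]/delta (negPf rx); lia.
have not_t x : x \in [:: f t; f (f t); e (f t); e (f (f t))] -> t <> x.
  rewrite !inE => /or4P[]/eqP->.
  - by move/esym/f_neq.
  - by move/esym/ff_neq.
  - by move=> tE; apply: (f_neq_s t); apply: (inv_inj eK); rewrite -tE.
  - by move=> tE; apply: (f_neq_s (f t)); apply: (inv_inj eK); rewrite -tE.
(* Such a collision would end at [rho t = t], against [not_t]. This provides the premises of [key]
   for [f s = f (e t)] and for [f (f s)]. *)
have not_collision i j : (i < j < 8)%N ->
    nth t (walk_ends t) i = nth t (walk_ends t) j ->
    nth t (walk_ends t) j \notin [:: f t; f (f t); e (f t); e (f (f t))].
  move=> ij /(collision ij); rewrite rho_t => tE.
  by apply/negP => /not_t; apply.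
have fs_rho : rho (f s) = f s.
  apply: key; last (by left); apply/eqP => /esym fsE;
  [have /= := @not_collision 2 3 isT|have /= := @not_collision 3 5 isT|
   have /= := @not_collision 3 4 isT|have /= := @not_collision 3 7 isT];
  by rewrite et fsE !inE eqxx ?orbT => /(_ erefl).
have ffs_rho : rho (f s) = f (f s).
  apply: key; last (by right); apply/eqP => /esym fsE;
  [have /= := @not_collision 2 6 isT|have /= := @not_collision 5 6 isT|
   have /= := @not_collision 4 6 isT|have /= := @not_collision 6 7 isT];
  by rewrite et fsE !inE eqxx ?orbT => /(_ erefl).
by case: (@f_neq (f s)); rewrite -ffs_rho fs_rho.
Qed.

Let f_inj : injective f.
Proof.
have [g gK] := fin_all_exists surjective.
have /bij_can_sym gf := injF_bij (can_inj gK).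
exact: can_inj ((gf _).2 gK).
Qed.

(** As [f] is a bijection, the sums in [balance] cancel, and [f (e u)] and [f (f (e u))] must both
    occur on the right; [e (rho u)] and [f (rho u)] are excluded as values of [f (e u)]. *)
Let commute_or_jump u : f (e u) = e (f u) \/ f (e u) = e (f (f u)).
Proof.
have sum_f phi : \sum_v phi v - \sum_v phi (f v) = 0.
  by rewrite (reindex_inj f_inj) subrr.
have ends x : x = f (e u) \/ x = f (f (e u)) ->
    [\/ e (rho u) = x, f (rho u) = x, e (f u) = x | e (f (f u)) = x].
  move=> xE; have := balance (delta x) u; rewrite sum_f addr0.
  have p1 : 0 <= delta x (rho (e u)) by apply: ler0n.
  have p2 : 0 <= delta x (rho (f u)) by apply: ler0n.
  have p3 : 0 <= delta x (f (e u)) by apply: ler0n.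
  have p4 : 0 <= delta x (f (f (e u))) by apply: ler0n.
  have p5 : 1 <= delta x (f (e u)) + delta x (f (f (e u))).
    by case: xE p3 p4 => <-; rewrite [delta x x]/delta eqxx; lia.
  move=> bal.
  have : 1 <= (e (rho u) == x)%:R + (f (rho u) == x)%:R
      + (e (f u) == x)%:R + (e (f (f u)) == x)%:R :> int.
    by move: bal p1 p2 p5; rewrite /delta; lia.
  by case/sum4_neq0 => /eqP; [exact: Or41|exact: Or42|exact: Or43|exact: Or44].
have repeat : e (f u) = f (f (e u)) \/ e (f (f u)) = f (f (e u)) ->
    rho u = f (f (e u)).
  case=> [col|col]; first exact: (@collision u 4 6).
  by rewrite -col; apply: (@collision u 6 7).
case: (ends _ (or_introl erefl)) => [e_rho|f_rho|efu|effu];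
  [| |by left|by right].
- case: (ends _ (or_intror erefl)) => [e_rho'|f_rho'|efu|effu].
  + by case: (@f_neq (f (e u))); rewrite -e_rho'.
  + by case: (@e_neq (rho u)); rewrite e_rho -(f_inj f_rho').
  + by case: (@e_neq_f (f (e u))); rewrite -{1}e_rho eK; apply: repeat; left.
  + by case: (@e_neq_f (f (e u))); rewrite -{1}e_rho eK; apply: repeat; right.
- have rhoE := f_inj f_rho.
  case: (ends _ (or_intror erefl)) => [e_rho'|f_rho'|efu|effu].
  + have : rho u = f (f (e u)).
      by apply: (@collision u 0 6); rewrite //= -e_rho' rhoE eK.
    by rewrite rhoE => /esym/ff_neq.
  + by case: (@f_neq (f (e u))); rewrite -f_rho' rhoE.
  + by case: (@ff_neq (e u)); rewrite -repeat //; left.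
  + by case: (@ff_neq (e u)); rewrite -repeat //; right.
Qed.

Lemma unit_degrees_absurd : G -> False.
Proof.
move=> u0; have commute u : f (e u) = e (f u).
  case: (commute_or_jump u) => // jump.
  (* A jump at both [u] and [e u] would repeat both [f (e u)] and [f (f (e u))]. *)
  have := commute_or_jump (e u); rewrite eK => -[->|jump']; first by rewrite eK.
  have rho1 : rho u = e (f (f u)) by apply: (@collision u 3 7).
  have rho2 : rho u = f (f (e u)).
    by apply: (@collision u 4 6); rewrite //= jump' eK.
  by case: (@f_neq (f (e u))); rewrite -rho2 rho1 -jump.
(* Commutation repeats both [e (f u0)] and [e (f (f u0))], which differ. *)
have rho1 : rho u0 = e (f u0).
  by apply: (@collision u0 3 4); rewrite //= commute.
have rho2 : rho u0 = e (f (f u0)).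
  by apply: (@collision u0 6 7); rewrite //= !commute.
by apply: (@f_neq (f u0)); apply: (inv_inj eK); rewrite -rho1.
Qed.

End UnitDegrees.

(** * Reduction to unit degrees *)

Theorem theorem4p2 (R : realType) (r z k : nat) (hr : (1 <= r)%N)
  (hz : (1 <= z)%N) (hk : (4 <= k)%N) :
  ~ exists G : mixedGraph, defect_graph R r z k 1 G.
Proof.
case=> G defectG; have k_gt1 : (1 < k)%N by apply: leq_trans hk.
have undirected_regular v := (defect1_regular hr hz k_gt1 defectG v).1.
have directed_regular v := (defect1_regular hr hz k_gt1 defectG v).2.
have [rho rhoP] := defect1_repeat hr hz k_gt1 defectG.
have neighbour (v : G) : exists w, edge v w.
  by apply/card_gt0P; rewrite -cardsE; have := undirected_regular v;
    rewrite /undirected_degree => ->.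
(* Without vertices the diameter would be the default [-oo]. *)
have [u _] : exists u : G, true.
  case: (pickP (xpredT : pred G)) => [u _|no_vertex]; first by exists u.
  have [diamG _ _ _] := defectG; move: diamG.
  by rewrite /diameter big1_seq // => -[x y]; have := no_vertex x.
have [u' uu'] := neighbour u.
case: k hk k_gt1 defectG rhoP => [|[|[|[|m]]]] // _ _ _ rhoP.
have [r1 z1 m0] :=
  excess_bound_small hr hz undirected_regular directed_regular rhoP uu'.
subst r z m.
have unique (e : rel G) v : #|[set w | e v w]| = 1%N ->
    exists w, forall x, e v x = (x == w).
  by move=> /eqP/cards1P[w ew]; exists w => x; rewrite -(in_set1 x w) -ew inE.
have [e eP] := fin_all_exists (fun v => unique _ v (undirected_regular v)).
have [f fP] := fin_all_exists (fun v => unique _ v (directed_regular v)).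
exact: (unit_degrees_absurd undirected_regular directed_regular rhoP eP fP u).
Qed.
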